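(* Let $p\geq 3$ be a prime number. For every integer $n\geq p$, the number of Dyck paths of semilength $n$ with $L=p$ is $$|\mathcal{D}_n^p| = 2\left(T_{n-2,p-1}+\sum_{i=0}^{n-2-p}(i+1)M_i\,T_{n-4-i,p-1}\right).$$ Thus the generating function $\sum_{n\ge 1}|\mathcal{D}_n^p|x^n$ is $$2x^p(1+xm(x))^{p-2}\left(x^2(xm(x))'+1\right),$$ where $'$ denotes the derivative with respect to $x$.
   Context: A Dyck path of semilength $n$ is a path from $(0,0)$ to $(2n,0)$ with up steps $u=(1,1)$ and down steps $d=(1,-1)$ that does not pass below the $x$-axis; $\mathcal{D}_n$ is the set of these. For $D\in\mathcal{D}_n$ and $1\le i\le n-1$, $r_i(D)$ is the number of down steps between the $i$th and $(i+1)$st up steps of $D$, and $s_i(D)$ is the number of up steps between the $i$th and $(i+1)$st down steps of $D$. The statistic $L$ is $L(D)=\prod_{i=1}^{n-1}\binom{r_i(D)+s_i(D)}{r_i(D)}$ (empty product $=1$). $\mathcal{D}_n^k=\{D\in\mathcal{D}_n : L(D)=k\}$. A Motzkin path of length $n$ is a path from $(0,0)$ to $(n,0)$ with steps $u=(1,1)$, $d=(1,-1)$, $h=(1,0)$ that does not pass below the $x$-axis; $M_n$ is the number of Motzkin paths of length $n$, and $m(x)=\sum_{n\ge 0}M_nx^n$. The Motzkin ballot numbers $T_{n,k}$ ($k\ge 1$, $n\ge k-1$) are defined as follows: for $n\ge k$, $T_{n,k}$ is the number of Motzkin paths of length $n$ whose first down step is the $k$th step; and $T_{k-1,k}=1$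 (counting the single Motzkin path consisting of $k-1$ horizontal steps). A sum whose upper limit is less than its lower limit is empty and equals $0$. *)

(* Defs.v *)
From HB Require Import structures.
From mathcomp Require Import all_boot all_order all_algebra.

Set Implicit Arguments.
Unset Strict Implicit.
Unset Printing Implicit Defensive.

Import Order.TTheory GRing.Theory Num.Theory.

Inductive step := Up | Down | Flat.

Definition option_bool_of_step (a : step) : option bool :=
  match a with Up => Some true | Down => Some false | Flat => None end.

Definition step_of_option_bool (b : option bool) : step :=
  match b with Some true => Up | Some false => Down | None => Flat end.

Lemma option_bool_of_stepK : cancel option_bool_of_step step_of_option_bool.
Proof. by case. Qed.

HB.instance Definition _ := Finite.copy step (can_type option_bool_of_stepK).

Definition rise (a : step) : int :=
  match a with Up => 1%R | Down => (-1)%R | Flat => 0%R end.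

Definition height (w : seq step) : int := (\sum_(a <- w) rise a)%R.

Definition axis_path (w : seq step) : bool :=
  (height w == 0%R) && [forall j : 'I_(size w).+1, (0 <= height (take j w))%R].

Definition Motzkin (n : nat) : {set n.-tuple step} :=
  [set w : n.-tuple step | axis_path w].

Definition Dyck (n : nat) : {set n.*2.-tuple step} :=
  [set w : n.*2.-tuple step | axis_path w & Flat \notin w].

(* 0-based position in w of the i-th occurrence (i >= 1) of the step a;
   equal to size w if there is no such occurrence. *)
Definition occ (a : step) (i : nat) (w : seq step) : nat :=
  nth (size w) [seq j <- iota 0 (size w) | nth Flat w j == a] i.-1.

Definition between (a b : step) (i : nat) (w : seq step) : nat :=
  count_mem b (drop (occ a i w).+1 (take (occ a i.+1 w) w)).

Definition r (i : nat) (w : seq step) : nat := between Up Down i w.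
Definition s (i : nat) (w : seq step) : nat := between Down Up i w.

Definition L (n : nat) (w : n.*2.-tuple step) : nat :=
  \prod_(1 <= i < n) 'C(r i w + s i w, r i w).

Definition DyckL (n k : nat) : {set n.*2.-tuple step} :=
  [set w in Dyck n | L w == k].

Definition M (n : nat) : nat := #|Motzkin n|.

(* The value is only meaningful for k >= 1 and n >= k - 1 (the else branch is
   then the convention T_{k-1,k} = 1); it is 0 outside this range. *)
Definition T (n k : nat) : nat :=
  if k <= n then #|[set w in Motzkin n | (index Down w).+1 == k]|
  else (n.+1 == k).

(* Formal power series over the integers, as coefficient sequences. *)
Definition fps := nat -> int.

Declare Scope fps_scope.
Delimit Scope fps_scope with fps.
Bind Scope fps_scope with fps.

Definition fpsC (c : int) : fps := fun n => if n is 0 then c else 0%R.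
Definition fpsX : fps := fun n => if n is 1 then 1%R else 0%R.
Definition fps_add (f g : fps) : fps := fun n => (f n + g n)%R.
Definition fps_mul (f g : fps) : fps :=
  fun n => (\sum_(i < n.+1) f i * g (n - i)%N)%R.
Definition fps_exp (f : fps) (k : nat) : fps := iter k (fps_mul f) (fpsC 1).
Definition fps_deriv (f : fps) : fps := fun n => (f n.+1 *+ n.+1)%R.

Notation "f + g" := (fps_add f g) : fps_scope.
Notation "f * g" := (fps_mul f g) : fps_scope.
Notation "f ^ k" := (fps_exp f k%N) : fps_scope.

Definition motzkin_gf : fps := fun n => Posz (M n).

Definition dyckL_gf (k : nat) : fps :=
  fun n => if n is 0 then 0%R else Posz #|DyckL n k|.

(* Main.v *)
Require Import Defs.
From HB Require Import structures.
From mathcomp Require Import all_boot all_order all_algebra.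
From mathcomp Require Import zify ring.

(** A Dyck path of semilength n.+1 is encoded by a word v of length n whose i-th
letter holds two bits: whether the i-th up step is followed by a down step (a
peak) and whether the i-th down step is followed by an up step (a valley). The
peak bits cut the up steps into ascents and the valley bits cut the down steps
into descents, so that v determines the path. Letters with only the valley bit
act as up steps, letters with only the peak bit as down steps, and the others,
among them None, which has both bits, as flat steps; the path does not go below
the axis if and only if v becomes a Motzkin path ([walk_dyck_of]).

The number r_i is nonzero exactly at a peak bit and s_i exactly at a valley
bit, so the i-th factor of L differs from 1 exactly when the i-th letter is
None. If L is a prime p, there is therefore a single None ([prime_weight]), and
v = Q None S with Q and S words in three letters; moreover a binomial
coefficient C(r + s, r) with r, s > 0 equals p only for {r, s} = {1, p - 1}
([bin_add_eq_prime]). Let h be the height reached by Q. The value of s at the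
None is the distance between the h-th and the next down step of S, where the
ends of S count as down steps, and r is the same distance in the mirror image of
Q ([weight_one_None]). So the paths with
L = p are counted by a sum over h of products of two numbers [gap_paths], one
for the distance 1 and one for the distance p - 1, in either order.

Put y = x m(x). The first-step recursion shows that paths from height h to 0
with a gap of c steps after their h-th down step have the generating function
x^c (1 + y)^c y^h ([coef_gap_paths]); for h = 0 and c = p - 2 its coefficients
are the Motzkin ballot numbers T_(m, p-1) ([gap_paths_T]). The two orders
contribute equally, and summing over h gives
  2 x^2 x^(p-2) (1 + y)^(p-2) (1 + y^2 + y^4 + ...).
Finally 1 / (1 - y^2) = 1 + x^2 y', which follows from y = x (1 + y + y^2) and
the derivative of this equation ([kernel_identity]). Both forms of the result
are readings of this product. Power series are replaced by integer polynomials
that agree with them up to a given degree, where identities hold up to a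
multiple of a power of x. *)

Set Implicit Arguments.
Unset Strict Implicit.
Unset Printing Implicit Defensive.

Import Order.TTheory GRing.Theory Num.Theory.

(** * Sums over words *)

(** Recursion on the first letter, in place of a sum over tuples, makes
first-step decompositions and the splitting of words hold by computation. *)
Fixpoint word_sum (T : finType) (n : nat) (F : seq T -> nat) : nat :=
  if n is n'.+1 then \sum_(x : T) word_sum n' (fun w => F (x :: w)) else F [::].

Section WordSum.
Variable T : finType.
Implicit Types (F G : seq T -> nat) (w : seq T).

Lemma eq_word_sum n F G :
  (forall w, size w = n -> F w = G w) -> word_sum n F = word_sum n G.
Proof.
elim: n F G => [|n IHn] F G eqFG /=; first exact: eqFG.
by apply: eq_bigr => x _; apply: IHn => w szw; apply: eqFG; rewrite /= szw.
Qed.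

Lemma word_sum_sum n (I : Type) (s : seq I) (P : pred I) (F : I -> seq T -> nat) :
  word_sum n (fun w => \sum_(i <- s | P i) F i w) =
  \sum_(i <- s | P i) word_sum n (F i).
Proof.
elim: n F => [|n IHn] F //=.
rewrite exchange_big /=; apply: eq_bigr => x _; exact: IHn.
Qed.

Lemma word_sum0 n : word_sum n (fun _ : seq T => 0) = 0.
Proof. by elim: n => //= n ->; rewrite big1. Qed.

Lemma word_sumD n F G :
  word_sum n (fun w => F w + G w) = word_sum n F + word_sum n G.
Proof.
elim: n F G => [|n IHn] F G //=; rewrite -big_split /=.
by apply: eq_bigr => x _; apply: IHn.
Qed.

Lemma word_sumMr n a F : word_sum n (fun w => F w * a) = word_sum n F * a.
Proof.
elim: n F => [|n IHn] F //=.
rewrite big_distrl /=; apply: eq_bigr => x _; exact: IHn.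
Qed.

Lemma word_sumMl n a F : word_sum n (fun w => a * F w) = a * word_sum n F.
Proof.
by rewrite mulnC -word_sumMr; apply: eq_word_sum => w _; rewrite mulnC.
Qed.

Lemma word_sum_rcons n F :
  word_sum n.+1 F = \sum_(x : T) word_sum n (fun w => F (rcons w x)).
Proof.
elim: n F => [|n IHn] F; first by [].
transitivity (\sum_(x : T) \sum_(y : T) word_sum n (fun w => F (x :: rcons w y))).
  by apply: eq_bigr => x _; apply: (IHn (fun w => F (x :: w))).
by rewrite exchange_big.
Qed.

Lemma word_sum_rev n F : word_sum n F = word_sum n (fun w => F (rev w)).
Proof.
elim: n F => [|n IHn] F //; rewrite word_sum_rcons /=.
apply: eq_bigr => x _; rewrite IHn; apply: eq_word_sum => w _.
by rewrite rev_cons.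
Qed.

Lemma word_sum_map n (f : T -> T) F :
  involutive f -> word_sum n F = word_sum n (fun w => F (map f w)).
Proof.
move=> fK; elim: n F => [|n IHn] F //=.
rewrite (reindex_inj (inv_inj fK)) /=; apply: eq_bigr => x _; exact: IHn.
Qed.

Lemma sum_tuple n F : \sum_(t : n.-tuple T) F t = word_sum n F.
Proof.
elim: n F => [|n IHn] F /=.
  by rewrite (big_pred1 [tuple]) // => t; rewrite [t]tuple0 /= eqxx.
under [RHS]eq_bigr => x _ do rewrite -IHn.
rewrite pair_big /=.
pose g (xt : T * n.-tuple T) : n.+1.-tuple T := [tuple of xt.1 :: xt.2].
pose h (t : n.+1.-tuple T) : T * n.-tuple T := (thead t, [tuple of behead t]).
rewrite (reindex g) //; exists h => [[x t] _|t _].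
  by rewrite /h /g /= theadE; congr pair; apply: val_inj.
by rewrite /g /= -tuple_eta.
Qed.

Lemma card_tuple_pred n (P : pred (seq T)) :
  #|[set t : n.-tuple T | P t]| = word_sum n (fun w => P w : nat).
Proof. by rewrite -sum_tuple -sum1dep_card big_mkcond. Qed.

End WordSum.

(** The two sets are compared through the lists of their words, which avoids
turning f into a function between tuples. *)
Lemma card_tuple_bij (T T' : finType) n n' (P : pred (seq T)) (P' : pred (seq T'))
    (f : seq T -> seq T') :
    (forall w, size w = n -> P w -> size (f w) = n' /\ P' (f w)) ->
    (forall w1 w2, size w1 = n -> size w2 = n -> P w1 -> P w2 ->
       f w1 = f w2 -> w1 = w2) ->
    (forall w', size w' = n' -> P' w' ->
       exists2 w, size w = n /\ P w & f w = w') ->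
  #|[set t : n.-tuple T | P t]| = #|[set t : n'.-tuple T' | P' t]|.
Proof.
move=> fP f_inj f_surj; set A := [set _ | _]; set B := [set _ | _].
have AP t : t \in enum A -> P t by rewrite mem_enum inE.
rewrite !cardE -(size_map (fun t : n.-tuple T => f t)).
rewrite -[RHS](size_map val); apply: perm_size; apply: uniq_perm.
- rewrite map_inj_in_uniq ?enum_uniq // => t u /AP Pt /AP Pu eq_f.
  by apply: val_inj; apply: f_inj => //; rewrite size_tuple.
- by rewrite map_inj_uniq ?enum_uniq //; apply: val_inj.
move=> w; apply/mapP/mapP => [[t /AP Pt ->]|[t]].
  have [sz_f Pf] := fP _ (size_tuple t) Pt.
  by exists (Tuple (introT eqP sz_f)); rewrite ?mem_enum ?inE.
rewrite mem_enum inE => Pt ->.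
have [u [szu Pu] fu] := f_surj _ (size_tuple t) Pt.
by exists (Tuple (introT eqP szu)); rewrite ?mem_enum ?inE.
Qed.

Lemma sum_option (T : finType) (F : option T -> nat) :
  \sum_x F x = F None + \sum_(x : T) F (Some x).
Proof.
rewrite (bigD1 None) //=; congr addn.
rewrite (reindex_omap Some id) => [|[]//].
by apply: eq_bigl => x; rewrite eqxx.
Qed.

Lemma word_sum_Some (T : finType) n (F : seq (option T) -> nat) :
    (forall v, None \in v -> F v = 0) ->
  word_sum n F = word_sum n (fun w : seq T => F (map Some w)).
Proof.
elim: n F => [|n IHn] F F0 //=; rewrite sum_option.
rewrite (@eq_word_sum _ n _ (fun=> 0)) => [|v _]; last first.
  by rewrite F0 // inE eqxx.
rewrite word_sum0; apply: eq_bigr => x _; apply: IHn => v v0.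
by apply: F0; rewrite inE v0 orbT.
Qed.

(** A word with a single None factors uniquely as Q None S, where k is the
length of Q. *)
Lemma word_sum_one_None (T : finType) n (F : seq (option T) -> nat) :
    (forall v, count_mem None v != 1 -> F v = 0) ->
  word_sum n F =
  \sum_(k < n) word_sum k (fun Q : seq T => word_sum (n.-1 - k)
     (fun S => F (map Some Q ++ None :: map Some S))).
Proof.
elim: n F => [|n IHn] F F0 /=; first by rewrite big_ord0 F0.
rewrite sum_option big_ord_recl /=; congr addn.
  rewrite subn0; apply: (@word_sum_Some _ _ (fun v => F (None :: v))) => v v0.
  by apply: F0 => /=; rewrite add1n eqSS -lt0n -has_count has_pred1.
under [RHS]eq_bigr => k _.
  rewrite /bump leq0n /= add1n.
  over.
rewrite exchange_big /=; apply: eq_bigr => x _.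
rewrite (IHn (fun v => F (Some x :: v))) => [|v v0]; last exact: F0.
by apply: eq_bigr => k _; rewrite -subn1 -subnDA add1n.
Qed.

(** * Walks *)

Definition move (h : nat) (x : step) : option nat :=
  match x, h with
  | Up, _ => Some h.+1
  | Flat, _ => Some h
  | Down, h'.+1 => Some h'
  | Down, 0 => None
  end.

(** The final height, or None if the walk would go below the axis. *)
Fixpoint walk (h : nat) (w : seq step) : option nat :=
  if w is x :: w' then obind (walk^~ w') (move h x) else Some h.

Lemma height_cons x w : height (x :: w) = (rise x + height w)%R.
Proof. exact: big_cons. Qed.

Lemma height_nil : height [::] = 0%R.
Proof. exact: big_nil. Qed.

Lemma walkP h w k : walk h w = Some k <->
  (h%:Z + height w = k%:Z)%R /\ forall j, (0 <= h%:Z + height (take j w))%R.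
Proof.
elim: w h => [|x w IHw] h.
  rewrite /= height_nil addr0; split=> [[->]|[[->] _] //].
  by split=> [//|[|j]]; rewrite ?height_nil ?addr0.
have shift h' : (h%:Z + rise x = h'%:Z)%R ->
  ((h'%:Z + height w = k%:Z)%R /\ forall j, (0 <= h'%:Z + height (take j w))%R) <->
  ((h%:Z + height (x :: w) = k%:Z)%R /\
   forall j, (0 <= h%:Z + height (take j (x :: w)))%R).
  move=> <-; rewrite height_cons addrA; split=> -[-> pos]; split=> // j.
    by case: j => [|j]; rewrite /= ?height_nil ?addr0 // height_cons addrA.
  by have := pos j.+1; rewrite /= height_cons addrA.
case: x shift => [||] shift.
- by rewrite /= IHw; apply: shift; rewrite /=; lia.
- case: h shift => [|h] shift /=; last by rewrite IHw; apply: shift => /=; lia.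
  by split=> // -[_ /(_ 1)]; rewrite /= take0 height_cons height_nil.
by rewrite /= IHw; apply: shift; rewrite /=; lia.
Qed.

Lemma axis_pathE w : axis_path w = (walk 0 w == Some 0).
Proof.
apply/idP/eqP => [/andP[/eqP h0 /forallP pos]|/walkP[h0 pos]].
  apply/walkP; split=> [|j]; first by rewrite h0.
  have [lt_j|le_j] := ltnP j (size w).+1.
    by rewrite add0r (pos (Ordinal lt_j)).
  by rewrite take_oversize ?h0 // ltnW.
rewrite /axis_path; move: h0; rewrite add0r => ->; rewrite eqxx.
by apply/forallP => j; have := pos j; rewrite add0r.
Qed.

Lemma walk_cat h u w : walk h (u ++ w) = obind (walk^~ w) (walk h u).
Proof. by elim: u h => //= x u IHu h; case: (move h x) => //= k; apply: IHu. Qed.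

Definition isUp (x : step) := if x is Up then true else false.
Definition isDown (x : step) := if x is Down then true else false.

Definition flip (x : step) : step :=
  match x with Up => Down | Down => Up | Flat => Flat end.

Lemma flipK : involutive flip. Proof. by case. Qed.

Lemma walk_rev h w k : walk h w = Some k -> walk k (map flip (rev w)) = Some h.
Proof.
elim: w h => [|x w IHw] h /=; first by case=> ->.
rewrite rev_cons map_rcons -cats1 walk_cat.
by case: x h => [h|[|h]|h] //= /IHw ->.
Qed.

Lemma walk_count h w k : walk h w = Some k ->
  h + count isUp w = k + count isDown w.
Proof.
elim: w h => [|x w IHw] h /=; first by case=> ->.
by case: x h => [h|[|h]|h] //= /IHw; lia.
Qed.

(** The prefix form of the Motzkin condition, which can be compared with
conditions on positions of letters. *)
Lemma walk_countP h w : walk h w = Some 0 <->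
  (forall i, count isDown (take i w) <= h + count isUp (take i w)) /\
  h + count isUp w = count isDown w.
Proof.
elim: w h => [|x w IHw] h.
  by rewrite /= addn0; split=> [[->]|[_ ->]].
have E (P Q P' Q' : Prop) : (Q <-> Q') -> (Q -> (P <-> P')) -> (P /\ Q <-> P' /\ Q').
  by tauto.
case: x h => [h|[|h]|h] /=.
- rewrite IHw; apply: E => [|_]; first by split; lia.
  by split=> le_du i;
    [case: i => [|i] //=; have := le_du i | have := le_du i.+1 => /=]; lia.
- split=> // -[/(_ 1)] /=; rewrite take0 /=; lia.
- rewrite IHw; apply: E => [|_]; first by split; lia.
  by split=> le_du i;
    [case: i => [|i] //=; have := le_du i | have := le_du i.+1 => /=]; lia.
rewrite IHw; apply: E => [|_]; first by split; lia.
by split=> le_du i;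
  [case: i => [|i] //=; have := le_du i | have := le_du i.+1 => /=]; lia.
Qed.

(** * Gaps between marked letters *)

(** The letters satisfying a cut w into 1 + count a w stretches; this is the
list of their lengths, with the stretches before the first cut and after the
last one included. *)
Definition gaps (T : Type) (a : pred T) (w : seq T) : seq nat :=
  foldr (fun x l => if a x then 0 :: l else incr_nth l 0) [:: 0] w.

Section Gaps.
Variables (T : Type) (a : pred T).
Implicit Types (u w : seq T).

Lemma size_gaps w : size (gaps a w) = (count a w).+1.
Proof.
elim: w => //= x w; case: (a x) => /= [-> //|].
by rewrite size_incr_nth => ->.
Qed.

Lemma gaps_neq_nil w : gaps a w <> [::].
Proof. by move=> /(congr1 size); rewrite size_gaps. Qed.

Lemma gaps_cat_cons u x w : a x -> gaps a (u ++ x :: w) = gaps a u ++ gaps a w.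
Proof.
move=> ax; elim: u => [|y u IHu] /=; first by rewrite ax.
rewrite IHu; case: (a y) => //.
by case: (gaps a u) (@gaps_neq_nil u).
Qed.

Lemma gaps_nseq u : ~~ has a u -> gaps a u = [:: size u].
Proof. by elim: u => //= x u IHu; rewrite negb_or => /andP[/negPf-> /IHu->]. Qed.

(** The counterpart, on the right, of the increment in the definition of gaps;
it serves to compute the gaps of a reversed word. *)
Lemma gaps_cat_last u w : ~~ has a w ->
  gaps a (u ++ w) = rcons (belast (head 0 (gaps a u)) (behead (gaps a u)))
                          (last 0 (gaps a u) + size w).
Proof.
move=> aw; elim: u => [|x u IHu] /=; first by rewrite gaps_nseq.
rewrite IHu; case: (a x) => /=.
  by case: (gaps a u) (@gaps_neq_nil u).
case: (gaps a u) (@gaps_neq_nil u) => // g [|g' s] _ //=.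
Qed.

Lemma gaps_rev w : gaps a (rev w) = rev (gaps a w).
Proof.
elim: w => //= x w IHw; rewrite rev_cons -cats1.
case ax: (a x); first by rewrite gaps_cat_cons // IHw rev_cons cats1.
rewrite gaps_cat_last /= ?ax // IHw.
case: (gaps a w) (@gaps_neq_nil w) => // g s _ /=; rewrite !rev_cons.
rewrite last_rcons; case/lastP: s => [|s y] /=; first by rewrite addn1.
by rewrite rev_rcons /= belast_rcons addn1.
Qed.

Lemma sumn_gaps w : sumn (gaps a w) + count a w = size w.
Proof.
elim: w => //= x w IHw; case: (a x) => /=; first lia.
by case: (gaps a w) (@gaps_neq_nil w) IHw => //= g s _; lia.
Qed.

(** The j-th letter satisfying a stands at the position
sumn (take j (gaps a w)) + j, counted from 1; having met j of them is the same
as having passed this position. *)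
Lemma leq_count_take w i j : j < size (gaps a w) ->
  (j <= count a (take i w)) = (sumn (take j (gaps a w)) + j <= i).
Proof.
elim: w i j => [|x w IHw] i j /=; first by case: j.
case: i => [|i]; first by case: j => [|j] _; rewrite ?take0 //=; lia.
have sz := size_gaps w.
move=> /=; case: (a x) => /=.
  by case: j => [//|j] /= lt_j; rewrite add1n ltnS IHw //; lia.
case: j => [|j]; first by rewrite take0.
case Dg: (gaps a w) sz => [//|g s] sz /= lt_j; rewrite IHw Dg /=; lia.
Qed.

End Gaps.

(** The gaps determine where the cuts are. *)
Lemma eq_gaps_map (T T' : Type) (a : pred T) (a' : pred T') w w' :
  (gaps a w = gaps a' w') -> map a w = map a' w'.
Proof.
elim: w w' => [|x w IHw] [|x' w'] //= eq_g.
- move: (congr1 sumn eq_g) (congr1 size eq_g) => /=.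
  case: (a' x') => /=; first by rewrite size_gaps.
  by case: (gaps a' w') => //= *; lia.
- move: (congr1 sumn eq_g) (congr1 size eq_g) => /=.
  case: (a x) => /=; first by rewrite size_gaps.
  by case: (gaps a w) => //= *; lia.
move: eq_g; case: (a x); case: (a' x') => //=.
- by case=> /IHw ->.
- by case: (gaps a' w').
- by case: (gaps a w).
move=> eq_g; congr cons; apply: IHw; move: eq_g.
by case: (gaps a w) (@gaps_neq_nil _ a w) => // g s _;
   case: (gaps a' w') (@gaps_neq_nil _ a' w') => // g' s' _ /= [-> ->].
Qed.

Lemma gaps_map (T T' : Type) (f : T -> T') (a : pred T') w :
  gaps a (map f w) = gaps (a \o f) w.
Proof. by elim: w => //= x w ->. Qed.

Lemma eq_gaps (T : Type) (a b : pred T) : a =1 b -> gaps a =1 gaps b.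
Proof. by move=> ab; elim=> //= x w ->; rewrite ab. Qed.

(** A section of [gaps id] on nonempty lists. *)
Fixpoint marks (l : seq nat) : seq bool :=
  match l with
  | [::] => [::]
  | [:: g] => nseq g false
  | g :: l' => nseq g false ++ true :: marks l'
  end.

Lemma gaps_marks l : l <> [::] -> gaps id (marks l) = l.
Proof.
elim: l => // g [|g' l] IHl _ /=.
  by rewrite gaps_nseq ?size_nseq // has_nseq andbF.
rewrite gaps_cat_cons // -/(marks (g' :: l)) IHl //.
by rewrite gaps_nseq ?size_nseq // has_nseq andbF.
Qed.

Lemma nth_gaps_rev (T : Type) (a : pred T) w k : k <= count a w ->
  nth 0 (gaps a (rev w)) k = nth 0 (gaps a w) (count a w - k).
Proof. by move=> le_k; rewrite gaps_rev nth_rev ?size_gaps // subSS. Qed.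

Lemma head_gaps_find (T : Type) (a : pred T) w : nth 0 (gaps a w) 0 = find a w.
Proof. by elim: w => //= x w <-; case: (a x) => //; rewrite nth_incr_nth. Qed.

Lemma occ_cons a x w i : 0 < i ->
  occ a i (x :: w) = if x == a then (if i == 1 then 0 else (occ a i.-1 w).+1)
                     else (occ a i w).+1.
Proof.
case: i => // i _; rewrite /occ /=.
rewrite -[1]/(1 + 0) iotaDl filter_map /=.
have -> : [seq i0 <- iota 0 (size w) |
             preim (addn 1) (fun j => nth Flat (x :: w) j == a) i0] =
         [seq j <- iota 0 (size w) | nth Flat w j == a].
  by apply: eq_filter => j.
set l := [seq _ <- _ | _].
have E k : nth (size w).+1 [seq 1 + j | j <- l] k = (nth (size w) l k).+1.
  have [lt_k|le_k] := ltnP k (size l); first by rewrite (nth_map (size w)).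
  by rewrite !nth_default ?size_map.
by case: (x == a) => //; case: i.
Qed.

(** In a word on two letters a and b, what lies between consecutive a's
consists of b's, so the count of b's there is a gap. *)
Lemma between_gaps a b w i :
    a != b -> {subset w <= [:: a; b]} ->
  between a b i.+1 w = nth 0 (gaps (pred1 a) w) i.+1.
Proof.
move=> ab; elim: w i => [|x w IHw] i sub_w.
  by rewrite /between /occ /= nth_nil.
have sub_w' : {subset w <= [:: a; b]}.
  by move=> y wy; apply: sub_w; rewrite inE wy orbT.
have take_occ u : {subset u <= [:: a; b]} ->
    count_mem b (take (occ a 1 u) u) = nth 0 (gaps (pred1 a) u) 0.
  elim: u => [|y u IHu] sub_u; first by rewrite /occ.
  have sub_u' : {subset u <= [:: a; b]}.
    by move=> z uz; apply: sub_u; rewrite inE uz orbT.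
  rewrite occ_cons //=; case: eqVneq => [//|ya] /=.
  rewrite nth_incr_nth IHu //; congr addn.
  by have := sub_u y (mem_head _ _); rewrite !inE (negPf ya) => /= ->.
rewrite /between !occ_cons //=; case: (x =P a) => [_|_] /=; last first.
  by rewrite nth_incr_nth /= add0n -IHw.
case: i => [|i] /=; first by rewrite drop0 take_occ.
exact: IHw.
Qed.

(** * Dyck words as peak-valley words *)

(** The entries of A and B are the lengths of the ascents and descents,
diminished by 1 because runs are nonempty. This makes them gaps between peak
bits and between valley bits. *)
Fixpoint word_of_runs (A B : seq nat) : seq step :=
  match A, B with
  | a :: A', b :: B' => nseq a.+1 Up ++ nseq b.+1 Down ++ word_of_runs A' B'
  | _, _ => [::]
  end.

Lemma word_of_runs_cons a A b B :
  word_of_runs (a :: A) (b :: B) = nseq a.+1 Up ++ nseq b.+1 Down ++ word_of_runs A B.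
Proof. by []. Qed.

Lemma word_of_runs_incr a A b B :
  word_of_runs (incr_nth (a :: A) 0) (b :: B) = Up :: word_of_runs (a :: A) (b :: B).
Proof. by []. Qed.

Lemma size_word_of_runs A B : size A = size B ->
  size (word_of_runs A B) = sumn A + sumn B + (size A).*2.
Proof.
elim: A B => [|a A IHA] [|b B] //= [szAB].
by rewrite size_cat /= size_cat !size_nseq IHA //; lia.
Qed.

Lemma Flat_notin_word_of_runs A B : Flat \notin word_of_runs A B.
Proof.
elim: A B => [|a A IHA] [|b B] //=.
by rewrite inE /= !(mem_cat, inE, mem_nseq) /= !andbF /= IHA.
Qed.

Lemma nseq_cat_inj (T : eqType) (x y : T) a b u w :
    head y u != x -> head y w != x -> nseq a x ++ u = nseq b x ++ w ->
  a = b /\ u = w.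
Proof.
move=> ux wx; elim: a b => [|a IHa] [|b] //= eq_uw.
- by rewrite eq_uw eqxx in ux.
- by rewrite -eq_uw eqxx in wx.
by case: eq_uw => /IHa[-> ->].
Qed.

Lemma word_of_runs_inj A B A' B' : size A = size B -> size A' = size B' ->
  word_of_runs A B = word_of_runs A' B' -> A = A' /\ B = B'.
Proof.
have hd C D : head Up (word_of_runs C D) != Down by case: C; case: D.
elim: A B A' B' => [|a A IHA] [|b B] [|a' A'] [|b' B'] // [szAB] [szAB'].
case/(@nseq_cat_inj _ Up Down a.+1 a'.+1) => // -[->].
by case/(@nseq_cat_inj _ Down Up b.+1 b'.+1) => // -[->] /IHA[] // -> ->.
Qed.

(** An initial run of down steps is allowed because removing the first up step
of a path may expose one. *)
Lemma word_of_runs_surj w : Flat \notin w -> last Down w = Down ->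
  exists c A B, size A = size B /\ w = nseq c Down ++ word_of_runs A B.
Proof.
elim: w => [|x w IHw]; first by exists 0, [::], [::].
rewrite inE negb_or => /andP[xF wF].
case: x xF => // _ /= lastw; last first.
  by have [c [A [B [szAB ->]]]] := IHw wF lastw; exists c.+1, A, B.
have lastDw: last Down w = Down by case: (w) lastw.
have [[|c] [A [B [szAB Dw]]]] := IHw wF lastDw; last first.
  by exists 0, (0 :: A), (c :: B); rewrite Dw /= szAB.
case: A B szAB Dw lastw => [|a A] [|b B] //= szAB Dw lastw.
  by rewrite Dw in lastw.
by exists 0, (a.+1 :: A), (b :: B); rewrite Dw.
Qed.

Lemma walk_nseq_Up h a w : walk h (nseq a Up ++ w) = walk (h + a) w.
Proof. by elim: a h => [|a IHa] h /=; rewrite ?addn0 // IHa addSnnS. Qed.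

Lemma walk_nseq_Down h b w :
  walk h (nseq b Down ++ w) = if b <= h then walk (h - b) w else None.
Proof. by elim: b h => [|b IHb] [|h] //=; rewrite ?subn0 // IHb. Qed.

Lemma walk_word_of_runs h A B : size A = size B ->
  walk h (word_of_runs A B) = Some 0 <->
  (forall k, sumn (take k B) <= h + sumn (take k A)) /\ h + sumn A = sumn B.
Proof.
elim: A B h => [|a A IHA] [|b B] h //.
  by rewrite /= addn0; split=> [[->]|[_ ->]].
case=> szAB.
rewrite word_of_runs_cons walk_nseq_Up walk_nseq_Down.
case: (leqP b.+1 (h + a.+1)) => [le_bh|lt_hb]; last first.
  by split=> // -[/(_ 1)]; rewrite /= !take0 /=; lia.
rewrite IHA //=; split=> -[leAB eqAB]; split; try lia.
  by case=> [|k] //=; have := leAB k; lia.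
by move=> k; have := leAB k.+1 => /=; lia.
Qed.

(** None is the letter with both bits, so that the words without such a letter
are the words over step. *)
Definition peak (x : option step) : bool :=
  match x with None | Some Down => true | _ => false end.
Definition valley (x : option step) : bool :=
  match x with None | Some Up => true | _ => false end.
Definition letter (a b : bool) : option step :=
  match a, b with
  | true, true => None
  | true, false => Some Down
  | false, true => Some Up
  | false, false => Some Flat
  end.

Lemma eq_peak_valley v v' :
  map peak v = map peak v' -> map valley v = map valley v' -> v = v'.
Proof.
elim: v v' => [|x v IHv] [|y v'] //= [pxy /IHv IH] [vxy /IH ->].
by case: x y pxy vxy => [[]|] [[]|].
Qed.

(** Letters with both bits or none leave the height unchanged. *)
Definition shadow (v : seq (option step)) : seq step := map (odflt Flat) v.

Lemma count_peak v :
  count peak v = count isDown (shadow v) + count (fun x => ~~ isSome x) v.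
Proof. by elim: v => //= -[[]|] v -> /=; lia. Qed.

Lemma count_valley v :
  count valley v = count isUp (shadow v) + count (fun x => ~~ isSome x) v.
Proof. by elim: v => //= -[[]|] v -> /=; lia. Qed.

(** The last up step and the last down step always end a run; v records the
bits of the others, and the last gap of v accounts for the last run. *)
Definition dyck_of (v : seq (option step)) :=
  word_of_runs (gaps peak v) (gaps valley v).

(** The path does not go below the axis when the first k descents are never longer
than the first k ascents, that is, when the k-th valley bit does not come after
the k-th peak bit. By [leq_count_take] this says that every prefix of v has at
least as many valley bits as peak bits, which is the condition on the shadow. *)
Lemma walk_dyck_of v : walk 0 (shadow v) = Some 0 <->
  count peak v = count valley v /\ walk 0 (dyck_of v) = Some 0.
Proof.
have -> : walk 0 (shadow v) = Some 0 <->
  (forall i, count peak (take i v) <= count valley (take i v)) /\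
  count peak v = count valley v.
  rewrite walk_countP !count_peak !count_valley /shadow.
  split=> -[le_pv eq_pv]; split; try lia.
    by move=> i; rewrite count_peak count_valley /shadow map_take; have := le_pv i; lia.
  by move=> i; have := le_pv i; rewrite count_peak count_valley /shadow map_take; lia.
have sz_p := size_gaps peak v; have sz_v := size_gaps valley v.
have sum_p := sumn_gaps peak v; have sum_v := sumn_gaps valley v.
split=> [[le_pv eq_pv]|[eq_pv]].
  split=> //; apply/walk_word_of_runs; first by lia.
  split=> [k|]; last lia.
  have [lt_k|le_k] := ltnP k (size (gaps peak v)); last by rewrite !take_oversize; lia.
  have:= leq_count_take (sumn (take k (gaps peak v)) + k) lt_k.
  have := le_pv (sumn (take k (gaps peak v)) + k).
  have := @leq_count_take _ valley v (sumn (take k (gaps peak v)) + k) k.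
  rewrite leqnn => E1 E2 E3.
  have: k <= count valley (take (sumn (take k (gaps peak v)) + k) v).
    by rewrite (leq_trans _ E2) // E3.
  rewrite E1; lia.
case/walk_word_of_runs => [|le_pv _]; first lia.
split=> // i; set j := count peak _.
have lt_j: j <= count peak v.
  by rewrite -[in leqRHS](cat_take_drop i v) count_cat leq_addr.
have:= @leq_count_take _ peak v i j; rewrite leqnn => Ep.
rewrite leq_count_take; last lia.
have := le_pv j; have := Ep; lia.
Qed.

Lemma nth_gaps_nseq (T : Type) (a : pred T) x b w i : ~~ a x ->
  nth 0 (gaps a (nseq b x ++ w)) i = (if i == 0 then b else 0) + nth 0 (gaps a w) i.
Proof.
move=> ax; elim: b => [|b IHb] /=; first by case: eqP.
by rewrite (negPf ax) nth_incr_nth IHb eq_sym; case: eqP.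
Qed.

Lemma nth_gaps_cons (T : Type) (a : pred T) x w i : a x ->
  nth 0 (gaps a (x :: w)) i.+1 = nth 0 (gaps a w) i.
Proof. by move=> /= ->. Qed.

(** The up step number i.+1 is followed by down steps only at a peak bit, and
then by a whole descent, whose rank is the number of earlier peaks. *)
Lemma nth_gaps_Up v B i : size B = (count peak v).+1 -> i < size v ->
  nth 0 (gaps isUp (word_of_runs (gaps peak v) B)) i.+1 =
  if peak (nth None v i) then (nth 0 B (count peak (take i v))).+1 else 0.
Proof.
have hd A C : nth 0 (gaps isUp (word_of_runs A C)) 0 = 0 by case: A; case: C.
elim: v B i => // x v IHv B i; rewrite [gaps _ (x :: v)]/= [count _ _]/=.
case px: (peak x).
  case: B => [//|b B] [szB]; rewrite word_of_runs_cons => lt_i.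
  rewrite [nseq 1 Up ++ _]cat1s nth_gaps_cons // nth_gaps_nseq //.
  case: i lt_i => [|i] lt_i.
    by rewrite /= px hd addn0.
  by rewrite IHv //= px.
move=> szB lt_i.
case Dg: (gaps peak v) (@gaps_neq_nil _ peak v) => [//|g s] _.
case: B szB => // b B szB.
rewrite word_of_runs_incr -Dg.
rewrite nth_gaps_cons //.
case: i lt_i => [|i] lt_i; first by rewrite hd /= px.
by rewrite IHv //= px.
Qed.

(** Dual to [nth_gaps_Up]; the ascent that follows the first descent is the
second one, whence the shift of rank. *)
Lemma nth_gaps_Down v A i : size A = (count valley v).+1 -> i < size v ->
  nth 0 (gaps isDown (word_of_runs A (gaps valley v))) i.+1 =
  if valley (nth None v i) then (nth 0 A (count valley (take i v)).+1).+1 else 0.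
Proof.
have hd a A' b B : nth 0 (gaps isDown (word_of_runs (a :: A') (b :: B))) 0 = a.+1.
  by rewrite word_of_runs_cons nth_gaps_nseq //= addn0.
elim: v A i => // x v IHv [//|a A] i [].
case Dg: (gaps valley v) (@gaps_neq_nil _ valley v) => [//|g s] _.
rewrite [gaps _ (x :: v)]/= [count _ _]/= Dg.
case vx: (valley x) => szA lt_i.
  rewrite word_of_runs_cons nth_gaps_nseq // [nseq 1 Down ++ _]cat1s nth_gaps_cons //.
  case: i lt_i => [|i] lt_i; last by rewrite -Dg IHv //= vx.
  by rewrite /= vx; case: A szA => // a' A _; rewrite hd.
rewrite [incr_nth _ _]/= word_of_runs_cons nth_gaps_nseq //= add0n.
case: i lt_i => [|i] lt_i; first by rewrite /= vx.
have := IHv (a :: A) i (congr1 S szA) lt_i.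
by rewrite Dg word_of_runs_cons nth_gaps_nseq //= vx.
Qed.

(** The values of r and s at the step number i.+1 of [dyck_of v], read off v,
when v has as many peaks as valleys. *)
Definition r_at (v : seq (option step)) (i : nat) : nat :=
  if peak (nth None v i) then (nth 0 (gaps valley v) (count peak (take i v))).+1
  else 0.
Definition s_at (v : seq (option step)) (i : nat) : nat :=
  if valley (nth None v i) then
    (nth 0 (gaps peak v) (count valley (take i v)).+1).+1
  else 0.

Lemma r_dyck_of v i : count peak v = count valley v -> i < size v ->
  r i.+1 (dyck_of v) = r_at v i.
Proof.
move=> eq_pv lt_i; rewrite /r between_gaps //; last first.
  by move=> x; case: x; rewrite ?inE // => /(negP (Flat_notin_word_of_runs _ _)).
rewrite (@eq_gaps _ _ isUp) => [|[]//]; rewrite nth_gaps_Up //.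
by rewrite size_gaps eq_pv.
Qed.

Lemma s_dyck_of v i : count peak v = count valley v -> i < size v ->
  s i.+1 (dyck_of v) = s_at v i.
Proof.
move=> eq_pv lt_i; rewrite /s between_gaps //; last first.
  by move=> x; case: x; rewrite ?inE // => /(negP (Flat_notin_word_of_runs _ _)).
rewrite (@eq_gaps _ _ isDown) => [|[]//]; rewrite nth_gaps_Down //.
by rewrite size_gaps eq_pv.
Qed.

(** The statistic L of [dyck_of v] when v has as many peaks as valleys. *)
Definition weight (v : seq (option step)) : nat :=
  \prod_(i < size v) 'C(r_at v i + s_at v i, r_at v i).

(** [dyck_of] is a bijection from the words of length n whose shadow is a Motzkin
path onto the Dyck words of semilength n.+1, and it carries the weight to L. *)
Lemma card_DyckL n k :
  #|DyckL n.+1 k| =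
  word_sum n (fun v => (walk 0 (shadow v) == Some 0) && (weight v == k) : nat).
Proof.
rewrite -(card_tuple_pred _ (fun v => (walk 0 (shadow v) == Some 0) && (weight v == k))).
pose Lw w := \prod_(1 <= i < n.+1) 'C(r i w + s i w, r i w).
have L_weight v : size v = n -> count peak v = count valley v ->
    Lw (dyck_of v) = weight v.
  move=> szv eq_pv; rewrite /Lw big_add1 big_mkord /weight szv.
  by apply: eq_bigr => i _; rewrite r_dyck_of ?s_dyck_of ?szv.
transitivity #|[set w : n.+1.*2.-tuple step |
    (axis_path w && (Flat \notin (w : seq step))) && (Lw w == k)]|.
  by apply: eq_card => w; rewrite !inE.
apply/esym.
apply: (@card_tuple_bij _ _ n n.+1.*2
  (fun v => (walk 0 (shadow v) == Some 0) && (weight v == k))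
  (fun w => (axis_path w && (Flat \notin w)) && (Lw w == k)) dyck_of).
- move=> v szv /andP[/eqP/walk_dyck_of[eq_pv walk_v] /eqP wt_v]; split.
    rewrite /dyck_of size_word_of_runs ?size_gaps ?eq_pv //.
    by have := sumn_gaps peak v; have := sumn_gaps valley v; rewrite szv; lia.
  by rewrite axis_pathE walk_v eqxx Flat_notin_word_of_runs L_weight // wt_v eqxx.
- move=> v v' szv szv'.
  move=> /andP[/eqP/walk_dyck_of[eq_v _] _] /andP[/eqP/walk_dyck_of[eq_v' _] _].
  move=> /word_of_runs_inj[||eq_p eq_q]; rewrite ?size_gaps ?eq_v ?eq_v' //.
  by apply: eq_peak_valley; apply: eq_gaps_map.
move=> w szw /andP[/andP[]]; rewrite axis_pathE => /eqP walk_w wF /eqP Lw_k.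
have last_w: last Down w = Down.
  case/lastP: w walk_w wF {szw Lw_k} => // w x /walk_rev.
  rewrite rev_rcons last_rcons mem_rcons inE.
  by case: x.
have [[|c] [A [B [szAB Dw]]]] := word_of_runs_surj wF last_w; last first.
  by rewrite Dw in walk_w.
rewrite /= in Dw; subst w.
have [_ sumAB] := (walk_word_of_runs 0 szAB).1 walk_w; rewrite add0n in sumAB.
have szE := size_word_of_runs szAB.
have A_nil : A <> [::] by move=> A0; rewrite A0 /= in szw.
have B_nil : B <> [::] by move=> B0; case: (A) A_nil szAB => //; rewrite B0.
have sz_marks C : C <> [::] -> size (marks C) = sumn C + (size C).-1.
  move=> /gaps_marks gC; rewrite -(sumn_gaps id) gC.
  by congr addn; rewrite -[in RHS]gC size_gaps.
have szmA : size (marks A) = n.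
  by rewrite sz_marks //; case: (A) A_nil szw szE szAB sumAB => //= a l *; lia.
have szmB : size (marks B) = n by rewrite sz_marks // -szAB -sumAB -sz_marks.
(* The marks on the up steps and on the down steps, paired, are the bits of v. *)
pose v := [seq letter p.1 p.2 | p <- zip (marks A) (marks B)].
have gp : gaps peak v = A.
  rewrite -[RHS]gaps_marks // /v gaps_map.
  rewrite -[in RHS](@unzip1_zip _ _ (marks A) (marks B)) ?szmA ?szmB //.
  by rewrite [RHS]gaps_map; apply: eq_gaps => -[[] []].
have gv : gaps valley v = B.
  rewrite -[RHS]gaps_marks // /v gaps_map.
  rewrite -[in RHS](@unzip2_zip _ _ (marks A) (marks B)) ?szmA ?szmB //.
  by rewrite [RHS]gaps_map; apply: eq_gaps => -[[] []].
have szv : size v = n by rewrite size_map size_zip szmA szmB minnn.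
have eq_pv : count peak v = count valley v.
  by apply: succn_inj; rewrite -!size_gaps gp gv.
have Dv : dyck_of v = word_of_runs A B by rewrite /dyck_of gp gv.
exists v => //; split=> //.
rewrite -L_weight // Dv Lw_k eqxx andbT.
by apply/eqP/walk_dyck_of; rewrite Dv.
Qed.

(** * The words of prime weight *)

(** Pascal's rule and induction on both arguments; at r = 2 the binomial
coefficient is a triangular number. *)
Lemma ltn_bin_add r s : 1 < r -> 1 < s -> r + s < 'C(r + s, r).
Proof.
elim: r s => // r IHr; elim=> // s IHs r_gt s_gt.
rewrite addSn binS.
have [r1|r_gt1] := leqP r 1; last first.
  have := IHr s.+1 r_gt1 s_gt; have := bin_gt0 (r + s.+1) r.+1; lia.
have -> : r = 1 by lia.
have := bin2 (1 + s.+1); rewrite bin1 add1n /= => ->.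
have: s.+1 <= (s.+2 * s.+1)./2 by rewrite geq_half_double; nia.
lia.
Qed.

Lemma prime_dvd_fact p n : prime p -> p %| n`! -> p <= n.
Proof.
move=> p_pr; elim: n => [|n IHn]; first by rewrite fact0 Euclid_dvd1.
rewrite factS Euclid_dvdM // => /orP[/dvdn_leq->//|/IHn]; exact: leqW.
Qed.

(** If r and s are at least 2, a prime value would divide (r + s)! and so be at
most r + s, which is smaller than the binomial coefficient. *)
Lemma bin_add_eq_prime p r s : prime p -> 0 < r -> 0 < s ->
  ('C(r + s, r) == p) = (r == 1) && (s == p.-1) || (r == p.-1) && (s == 1).
Proof.
move=> p_pr r_gt0 s_gt0; have p_gt1 := prime_gt1 p_pr.
have [r1|r_neq1] := eqVneq r 1; first by rewrite r1 bin1; lia.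
have [s1|s_neq1] := eqVneq s 1.
  rewrite s1 -(@bin_sub (r + 1) r) ?leq_addr // addKn bin1; lia.
rewrite andbF; apply/negbTE/eqP => bin_p.
have: p %| (r + s)`! by rewrite -bin_p -(@bin_fact (r + s) r) ?leq_addr // dvdn_mulr.
move/(prime_dvd_fact p_pr) => le_p.
by have := @ltn_bin_add r s; lia.
Qed.

Lemma prime_prod_count (s : seq nat) :
  prime (\prod_(x <- s) x) -> count (fun x => x != 1) s = 1.
Proof.
elim: s => [|x s IHs]; first by rewrite big_nil.
rewrite big_cons /=; have [->|x_neq1] := eqVneq x 1; first by rewrite mul1n.
move=> p_pr; have := primeP p_pr => -[_ /(_ x (dvdn_mulr _ (dvdnn x)))].
rewrite (negPf x_neq1) /= => /eqP x_eq.
have {x_eq}: \prod_(y <- s) y == 1.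
  have := prime_gt0 p_pr; rewrite -x_eq => x_gt0.
  by rewrite -(eqn_pmul2l x_gt0) -x_eq muln1.
elim: s {IHs p_pr} => //= y s IHs; rewrite big_cons muln_eq1 => /andP[-> /IHs /=].
by rewrite add0n.
Qed.

(** A letter that is not None lacks one of the two bits, so r or s vanishes
there. *)
Lemma bin_at_eq1 v i :
  ('C(r_at v i + s_at v i, r_at v i) == 1) = (nth None v i != None).
Proof.
rewrite /r_at /s_at; case: (nth None v i) => [[]|] /=; rewrite ?addn0 ?binn ?bin0 //.
set a := nth _ _ _; set b := nth _ _ _.
rewrite addSn binS; apply/negbTE.
have := bin_gt0 (a + b.+1) a.+1; have := bin_gt0 (a + b.+1) a; lia.
Qed.

Lemma prime_weight v : prime (weight v) -> count_mem None v = 1.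
Proof.
pose f i := 'C(r_at v i + s_at v i, r_at v i).
have -> : weight v = \prod_(x <- [seq f i | i <- iota 0 (size v)]) x.
  by rewrite big_map /weight -(big_mkord xpredT f) /index_iota subn0.
move/prime_prod_count; rewrite count_map => <-.
rewrite -[in LHS](mkseq_nth None v) /mkseq count_map.
by apply: eq_count => i /=; rewrite bin_at_eq1 negbK.
Qed.

Definition mirror (w : seq step) := map flip (rev w).

Lemma mirrorK : involutive mirror.
Proof. by move=> w; rewrite /mirror -map_rev revK mapK //; apply: flipK. Qed.

Lemma walk_mirror h k w : (walk h w == Some k) = (walk k (mirror w) == Some h).
Proof.
apply/eqP/eqP; first exact: walk_rev.
by move/walk_rev; rewrite -/(mirror _) mirrorK.
Qed.

Lemma word_sum_mirror n (F : seq step -> nat) :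
  word_sum n F = word_sum n (fun w => F (mirror w)).
Proof. by rewrite (word_sum_map _ _ flipK) word_sum_rev. Qed.

(** A walk Q from 0 to h has h more valley bits than peak bits. The descent that
follows the None is the one whose rank is the number of peaks of Q, so it is the
gap of index h from the right among the valley gaps of Q, hence a gap of the
mirror image. The ascent that follows the None has a rank counted by the
valleys of Q, which is h beyond the peaks of Q. *)
Lemma weight_one_None Q S h : walk 0 Q = Some h ->
  weight (map Some Q ++ None :: map Some S) =
  let r0 := (nth 0 (gaps isDown (mirror Q)) h).+1 in
  let s0 := (nth 0 (gaps isDown S) h).+1 in
  'C(r0 + s0, r0).
Proof.
move=> /walk_count; rewrite add0n => DQ.
set v := _ ++ _.
have szv : size v = size Q + (size S).+1 by rewrite size_cat /= !size_map.
have szQ : size Q < size v by lia.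
have nthQ : nth None v (size Q) = None by rewrite nth_cat size_map ltnn subnn.
have takeQ : take (size Q) v = map Some Q.
  by rewrite -[size Q](size_map Some) take_size_cat.
have peakE (w : seq step) : count peak (map Some w) = count isDown w.
  by rewrite count_map; apply: eq_count => -[].
have valleyE (w : seq step) : count valley (map Some w) = count isUp w.
  by rewrite count_map; apply: eq_count => -[].
have gpE (w : seq step) : gaps peak (map Some w) = gaps isDown w.
  by rewrite gaps_map; apply: eq_gaps => -[].
have gvE (w : seq step) : gaps valley (map Some w) = gaps isUp w.
  by rewrite gaps_map; apply: eq_gaps => -[].
rewrite /weight (bigD1 (Ordinal szQ)) //= big1 ?muln1 => [|i ne_i]; last first.
  apply/eqP; rewrite bin_at_eq1 nth_cat size_map; case: ltnP => [lt_i|le_i].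
    by rewrite (nth_map Flat).
  have lt_i: size Q < i by rewrite ltn_neqAle eq_sym ne_i.
  rewrite -(subnSK lt_i) /= (nth_map Flat) //.
  by have := ltn_ord i; lia.
have -> : r_at v (size Q) = (nth 0 (gaps isDown (mirror Q)) h).+1.
  rewrite /r_at nthQ /= takeQ peakE gaps_cat_cons // gvE gvE nth_cat size_gaps DQ.
  rewrite ifT; last lia.
  congr _.+1; rewrite gaps_map (@eq_gaps _ _ isUp) => [|[]//].
  by rewrite nth_gaps_rev DQ ?leq_addr // addKn.
have -> : s_at v (size Q) = (nth 0 (gaps isDown S) h).+1; last by [].
rewrite /s_at nthQ /= takeQ valleyE gaps_cat_cons // gpE gpE nth_cat size_gaps DQ.
by rewrite ifF ?subSS ?addnK //; lia.
Qed.

(** The numbers of walks from height k + b to 0 with c steps between the k-th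
down step (the start of the walk for k = 0) and the next one (or the end). The
start is k + b rather than k because up steps taken before the k-th down step
raise b in the recursion. *)
Definition gap_paths (c m k b : nat) : nat :=
  word_sum m (fun w =>
    (walk (k + b) w == Some 0) && (nth 0 (gaps isDown w) k == c) : nat).

(** Splitting at the None turns the count into a convolution over the length k
of Q, where h is the height at the None. *)
Lemma card_DyckL_prime n p : prime p -> 3 <= p ->
  #|DyckL n.+1 p| = \sum_(k < n) \sum_(h < n)
    (gap_paths 0 k h 0 * gap_paths (p - 2) (n.-1 - k) h 0 +
     gap_paths (p - 2) k h 0 * gap_paths 0 (n.-1 - k) h 0).
Proof.
move=> p_pr p_ge3; rewrite card_DyckL word_sum_one_None => [|v v1]; last first.
  case: eqP => //= _; case: eqP => // wt_p; case/eqP: v1.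
  by apply: prime_weight; rewrite wt_p.
apply: eq_bigr => k _.
pose A c w h := (walk h w == Some 0) && (nth 0 (gaps isDown w) h == c) : nat.
transitivity (word_sum k (fun Q => word_sum (n.-1 - k) (fun S =>
   \sum_(h < n) (A 0 (mirror Q) h * A (p - 2) S h + A (p - 2) (mirror Q) h * A 0 S h)))).
  apply: eq_word_sum => Q szQ; apply: eq_word_sum => S szS.
  have -> : shadow (map Some Q ++ None :: map Some S) = Q ++ Flat :: S.
    by rewrite /shadow map_cat /= !mapK.
  rewrite walk_cat /=.
  case DQ: (walk 0 Q) => [h|] /=; last first.
    rewrite big1 // => h _; rewrite /A -walk_mirror DQ.
    by [].
  have lt_h : h < n.
    have := ltn_ord k; rewrite -szQ; apply: leq_ltn_trans.
    apply: leq_trans (count_size isUp Q).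
    by rewrite -[leqRHS]/(0 + _) (walk_count DQ) leq_addr.
  rewrite (bigD1 (Ordinal lt_h)) //= big1 => [|h' ne_h]; last first.
    rewrite /A -walk_mirror DQ; case: eqP => // -[eq_h].
    by rewrite -val_eqE /= eq_h eqxx in ne_h.
  rewrite addn0 (weight_one_None _ DQ) /= bin_add_eq_prime //.
  rewrite /A -walk_mirror DQ eqxx /=.
  case: (walk h S == _) => /=; last by rewrite !muln0.
  set a := nth _ _ _; set b := nth _ _ _.
  have -> : (b.+1 == p.-1) = (b == p - 2) by lia.
  have -> : (a.+1 == p.-1) = (a == p - 2) by lia.
  rewrite !eqSS; case: (a =P 0) => [->|_]; case: (b =P 0) => [->|_] /=.
  - by have -> : (0 == p - 2) = false by lia.
  - by rewrite andbF orbF mul1n muln0 addn0.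
  - by rewrite andbT mul0n muln1.
  by rewrite andbF mul0n muln0.
have gapE c m h : gap_paths c m h 0 = word_sum m (fun S => A c S h).
  by rewrite /gap_paths addn0.
have gap_mirrorE c h :
    gap_paths c k h 0 = word_sum k (fun Q => A c (mirror Q) h).
  by rewrite gapE word_sum_mirror.
transitivity (word_sum k (fun Q => \sum_(h < n)
   (A 0 (mirror Q) h * gap_paths (p - 2) (n.-1 - k) h 0 +
    A (p - 2) (mirror Q) h * gap_paths 0 (n.-1 - k) h 0))).
  apply: eq_word_sum => Q _; rewrite word_sum_sum; apply: eq_bigr => h _.
  by rewrite word_sumD !word_sumMl -!gapE.
rewrite word_sum_sum; apply: eq_bigr => h _.
by rewrite word_sumD !word_sumMr -!gap_mirrorE.
Qed.

(** * First-step recursions for Motzkin and gap paths *)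

Lemma sum_step (F : step -> nat) : \sum_(x : step) F x = F Up + F Down + F Flat.
Proof.
rewrite (bigD1 Up) //= (bigD1 Down) //= (bigD1 Flat) //= big1; last by case.
by rewrite addn0 addnA.
Qed.

Definition motzkin_from (b n : nat) : nat :=
  word_sum n (fun w => walk b w == Some 0 : nat).

Lemma motzkin_from0 b : motzkin_from b 0 = (b == 0).
Proof. by case: b. Qed.

Lemma motzkin_fromS b n : motzkin_from b n.+1 =
  motzkin_from b.+1 n + (if b is b'.+1 then motzkin_from b' n else 0) + motzkin_from b n.
Proof.
rewrite /motzkin_from [LHS]/= sum_step; case: b => [|b] //=.
by rewrite (@word_sum0 step).
Qed.

Lemma M_motzkin_from n : M n = motzkin_from 0 n.
Proof.
rewrite /motzkin_from -(card_tuple_pred _ (fun w => walk 0 w == Some 0)).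
by apply: eq_card => w; rewrite !inE axis_pathE.
Qed.

(** Decomposition at the first passage to height b. It is proved without cutting
paths: both sides satisfy the same first-step recursion. *)
Lemma motzkin_from_conv b n :
  \sum_(i < n) motzkin_from b i * motzkin_from 0 (n.-1 - i) = motzkin_from b.+1 n.
Proof.
elim: n b => [|n IHn] b; first by rewrite big_ord0.
rewrite big_ord_recl /= subn0 motzkin_from0 motzkin_fromS.
under eq_bigr => i _.
  rewrite /bump leq0n add1n motzkin_fromS !mulnDl.
  have -> : n - i.+1 = n.-1 - i by lia.
  over.
rewrite !big_split /= !IHn.
case: b => [|b]; last by rewrite IHn; lia.
by rewrite big1 //= ; lia.
Qed.

Lemma gap_pathsS c m k b : gap_paths c m.+1 k.+1 b =
  gap_paths c m k.+1 b.+1 + gap_paths c m k b + gap_paths c m k.+1 b.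
Proof.
rewrite /gap_paths [LHS]/= sum_step; congr (_ + _ + _); apply: eq_word_sum => w _ /=.
  by rewrite nth_incr_nth addnS.
by rewrite nth_incr_nth.
Qed.

Lemma gap_paths0S c m b : gap_paths c.+1 m.+1 0 b =
  gap_paths c m 0 b.+1 + gap_paths c m 0 b.
Proof.
pose F w := (walk b w == Some 0) && (nth 0 (gaps isDown w) 0 == c.+1) : nat.
rewrite -[LHS]/(\sum_(x : step) word_sum m (fun w => F (x :: w))) sum_step.
have -> : word_sum m (fun w => F (Down :: w)) = 0.
  by rewrite -[RHS](word_sum0 step m); apply: eq_word_sum => w _; rewrite /F /= andbF.
rewrite addn0; congr (_ + _); apply: eq_word_sum => w _;
  by rewrite /F /= nth_incr_nth eqSS.
Qed.

Lemma gap_paths00 m b :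
  gap_paths 0 m.+1 0 b = if b is b'.+1 then motzkin_from b' m else 0.
Proof.
rewrite /gap_paths [LHS]/= sum_step.
have hd w : (nth 0 (incr_nth (gaps isDown w) 0) 0 == 0) = false by rewrite nth_incr_nth.
under eq_word_sum => w _ do rewrite /= hd andbF.
rewrite word_sum0 add0n.
under [X in _ + X]eq_word_sum => w _ do rewrite /= hd andbF.
rewrite word_sum0 addn0 /motzkin_from.
case: b => [|b]; first by rewrite -[RHS](word_sum0 step m); apply: eq_word_sum.
by apply: eq_word_sum => w _ /=; rewrite andbT.
Qed.

(** A walk of length at most c with a first gap of c can only be the walk with
c flat steps; this accounts for the convention T_(k-1, k) = 1. *)
Lemma gap_paths_small c m b : m <= c ->
  gap_paths c m 0 b = (m == c) && (b == 0).
Proof.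
elim: m c b => [|m IHm] [|c] b //= le_mc; last by rewrite gap_paths0S !IHm // andbF.
  by rewrite /gap_paths /=; case: b.
by rewrite /gap_paths /= andbF.
Qed.

Lemma gap_paths_T c m : T m c.+1 = gap_paths c m 0 0.
Proof.
rewrite /T; case: (leqP c.+1 m) => [_|lt_mc]; last by rewrite gap_paths_small ?andbT.
rewrite /gap_paths.
rewrite -(card_tuple_pred _ (fun w =>
  (walk (0 + 0) w == Some 0) && (nth 0 (gaps isDown w) 0 == c))).
apply: eq_card => w; rewrite !inE axis_pathE head_gaps_find eqSS; congr (_ && (_ == c)).
by apply: eq_find => -[].
Qed.

(** * Generating functions as truncated polynomials *)

Local Open Scope ring_scope.

Section GF.
Variable N : nat.

Definition motzkin_poly : {poly int} := \poly_(i < N) (M i)%:Z.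

(** The truncation of y = x m(x); its coefficients are those of the series up to
degree N. *)
Definition xm_poly : {poly int} := 'X * motzkin_poly.
Local Notation y := xm_poly.

(** A walk from height b to 0 is a sequence of b.+1 Motzkin paths separated by
b down steps. *)
Lemma coef_xm_poly_exp b n : (n < N)%N -> (y ^+ b.+1)`_n.+1 = (motzkin_from b n)%:Z.
Proof.
elim: b n => [|b IHb] n lt_nN.
  by rewrite expr1 coefXM /= coef_poly lt_nN M_motzkin_from.
rewrite exprSr [X in _ * X]/xm_poly mulrCA coefXM /= coefM big_ord_recl /=.
rewrite exprS -mulrA coefXM mul0r add0r.
rewrite -motzkin_from_conv -natz natr_sum; apply: eq_bigr => i _.
rewrite /bump leq0n add1n mulrA -exprS IHb; last by have := ltn_ord i; lia.
rewrite coef_poly ifT; last by have := ltn_ord i; lia.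
by rewrite M_motzkin_from natz PoszM; congr (_ * Posz (motzkin_from _ _)); lia.
Qed.

Lemma xm_poly_equation : exists e, y = 'X * (1 + y + y ^+ 2) + 'X^(N.+1) * e.
Proof.
set d := y - 'X * (1 + y + y ^+ 2).
exists (drop_poly N.+1 d); apply/eqP.
rewrite addrC -subr_eq -/d -{1}(poly_take_drop N.+1 d).
rewrite mulrC eq_sym -subr_eq0 opprD addrA addrC addrA addNr add0r oppr_eq0.
apply/eqP/polyP => i; rewrite coef_take_poly coef0; case: ltnP => // lt_i.
have y1 n : (n < N)%N -> y`_n.+1 = (motzkin_from 0 n)%:Z.
  by move=> lt_n; rewrite -coef_xm_poly_exp.
rewrite /d coefB [('X * (_ + _))`_i]coefXM !coefD coef1.
case: i lt_i => [|[|n]] lt_i /=.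
- by rewrite coefXM.
- by rewrite y1 // motzkin_from0 expr2 -mulrA !coefXM.
rewrite !y1 ?coef_xm_poly_exp; [|lia..].
by rewrite motzkin_fromS; lia.
Qed.

(** The first step of a walk with k > 0 leads to (k, b + 1), (k - 1, b) or (k, b),
which matches multiplication by y = x (1 + y + y^2). For k = 0 and c > 0 it must
not be a down step, whence the factors x (1 + y), and for k = c = 0 it must be
a down step. *)
Lemma coef_gap_paths c m k b : (m <= N)%N ->
  ('X^c * (1 + y) ^+ c * y ^+ (k + b))`_m = (gap_paths c m k b)%:Z.
Proof.
have [e y_eq] := xm_poly_equation.
elim: m c k b => [|m IHm] c k b le_mN.
  case: c => [|c]; last first.
    by rewrite exprS -!mulrA coefXM /gap_paths; case: k => [|k]; rewrite /= ?andbF.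
  rewrite expr0 mul1r expr0 mul1r /gap_paths /=.
  case: k => [|k]; first by case: b => [|b] //; rewrite /= ?coef1 // exprS -mulrA coefXM.
  by rewrite /= addSn exprS -mulrA coefXM.
have le_m : (m <= N)%N by lia.
case: k => [|k].
  case: c => [|c].
    rewrite expr0 mul1r expr0 mul1r gap_paths00.
    by case: b => [|b]; rewrite ?coef1 // add0n coef_xm_poly_exp.
  rewrite gap_paths0S PoszD -!IHm // -coefD.
  have -> : 'X^(c.+1) * (1 + y) ^+ c.+1 * y ^+ (0 + b) =
     'X * ('X^c * (1 + y) ^+ c * y ^+ (0 + b.+1) + 'X^c * (1 + y) ^+ c * y ^+ (0 + b)).
    by rewrite !add0n !exprS; ring.
  by rewrite coefXM.
rewrite gap_pathsS !PoszD -!IHm // -!coefD.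
set P := 'X^c * (1 + y) ^+ c.
have step_eq (Q Y z x t f : {poly int}) : z = x * (1 + z + z ^+ 2) + t * f ->
    Q * (z * Y) = x * (Q * (z * (z * Y)) + Q * Y + Q * (z * Y)) + t * (f * Q * Y).
  by move=> {1}->; ring.
have E := step_eq P (y ^+ (k + b)) _ _ _ _ y_eq; rewrite -!exprS in E.
rewrite addnS !addSn [in LHS]E.
by rewrite [LHS]coefD coefXM coefXnM ltnS le_mN addr0.
Qed.

End GF.

(** Here z' plays the role of the derivative of z and t that of the power of x up
to which the identities hold. Modulo t, x (1 - z^2) = z (1 - x - 2xz) by the
first equation and (1 - x - 2xz) z' = 1 + z + z^2 by the second one; so
x^2 (1 - z^2) z' = z x (1 + z + z^2) = z^2. *)
Lemma kernel_identity (R : comNzRingType) (x z z' t e g : R) :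
    z = x * (1 + z + z ^+ 2) + x * t * e ->
    z' = 1 + z + z ^+ 2 + x * (1 + z *+ 2) * z' + t * g ->
  (1 + x ^+ 2 * z') * (1 - z ^+ 2) = 1 + t * (x * z * g - x * e * (z + x * z')).
Proof.
move=> z_eq z'_eq.
have -> : (1 + x ^+ 2 * z') * (1 - z ^+ 2) =
    1 + x * z * (z' - (1 + z + z ^+ 2 + x * (1 + z *+ 2) * z'))
      - (z - x * (1 + z + z ^+ 2)) * (z + x * z') by ring.
have -> : z' - (1 + z + z ^+ 2 + x * (1 + z *+ 2) * z') = t * g.
  by rewrite {1}z'_eq addrAC subrr add0r.
have -> : z - x * (1 + z + z ^+ 2) = x * t * e by rewrite {1}z_eq addrAC subrr add0r.
by ring.
Qed.

Lemma deriv_quadratic (z e : {poly int}) n :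
    z = 'X * (1 + z + z ^+ 2) + 'X^(n.+2) * e ->
  z^`() = 1 + z + z ^+ 2 + 'X * (1 + z *+ 2) * z^`()
          + 'X^(n.+1) * (e *+ n.+2 + 'X * e^`()).
Proof.
move=> z_eq; rewrite [LHS](congr1 deriv z_eq).
rewrite !(derivD, derivM, derivX, derivXn, derivC) /= ['X^(n.+2)]exprS.
rewrite -[e *+ _]mulr_natl -['X^_ *+ _]mulr_natl.
move: n.+2%:R 'X^(n.+1) => k t; ring.
Qed.

(** The sum is 1 / (1 - y^2) up to a multiple of a power of x, because y is
divisible by x. *)
Lemma geometric_sum_xm_poly n : let y := xm_poly n.+1 in
  exists Z, \sum_(h < n.+1) (y ^+ 2) ^+ h = 1 + 'X ^+ 2 * y^`() + 'X^(n.+1) * Z.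
Proof.
move=> y; have [e y_eq] := xm_poly_equation n.+1; rewrite -/y in y_eq.
set t := 'X^(n.+1).
have y_eqt : y = 'X * (1 + y + y ^+ 2) + 'X * t * e by rewrite -exprS.
have y'_eq := deriv_quadratic y_eq.
have K := kernel_identity y_eqt y'_eq.
set S := \sum_(h < _) _.
have geom : S * (1 - y ^+ 2) = 1 - (y ^+ 2) ^+ n.+1.
  by apply: oppr_inj; rewrite -mulrN !opprB mulrC -subrX1.
have ypow : (y ^+ 2) ^+ n.+1 = t * ('X * motzkin_poly n.+1 ^+ 2) ^+ n.+1.
  by rewrite -exprMn; congr (_ ^+ _); rewrite /y /xm_poly; ring.
set W := 'X * y * _ - _ in K.
exists (- (1 + 'X ^+ 2 * y^`()) * ('X * motzkin_poly n.+1 ^+ 2) ^+ n.+1 - S * W).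
have S_eq : S = S * ((1 + 'X ^+ 2 * y^`()) * (1 - y ^+ 2) - t * W).
  by rewrite K addrK mulr1.
rewrite [LHS]S_eq mulrBr mulrCA geom ypow; ring.
Qed.

(** In the convolution of [card_DyckL_prime] one gap contributes y^h and the other
x^c (1 + y)^c y^h, in either order. *)
Lemma card_DyckL_coef n p : prime p -> (3 <= p)%N ->
  let y := xm_poly n.+1 in let c := (p - 2)%N in
  #|DyckL n.+2 p|%:Z = ('X^c * (1 + y) ^+ c * ('X ^+ 2 * y^`() + 1))`_n *+ 2.
Proof.
move=> p_pr p_ge3 y c; rewrite card_DyckL_prime // -/c.
pose A d h : {poly int} := 'X^d * (1 + y) ^+ d * y ^+ h.
have coefA d m h : (m <= n)%N -> (gap_paths d m h 0)%:Z = (A d h)`_m.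
  by move=> le_mn; rewrite -(@coef_gap_paths n.+1) ?addn0 ?leqW.
have [Z sumZ] := geometric_sum_xm_poly n.
transitivity (\sum_(h < n.+1) ((A 0%N h * A c h)`_n + (A c h * A 0%N h)`_n)).
  rewrite exchange_big /= -natz natr_sum; apply: eq_bigr => h _.
  rewrite !coefM -big_split /= natr_sum; apply: eq_bigr => k _.
  by rewrite natz PoszD !PoszM !coefA ?leq_subr // -ltnS.
under eq_bigr => h _.
  rewrite [A c h * _]mulrC -mulr2n.
  have -> : A 0%N h * A c h = 'X^c * (1 + y) ^+ c * (y ^+ 2) ^+ h.
    by rewrite /A -exprM mulnC exprM expr0 mul1r expr0 mul1r; ring.
  over.
rewrite /= sumrMnl -coef_sum -mulr_sumr sumZ ['X^2 * _ + 1]addrC.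
rewrite [in LHS]mulrDr [in LHS]coefD.
rewrite [X in _ + X](_ : _ = 0) ?addr0 //.
by rewrite mulrCA coefXnM ltnS leqnn.
Qed.

(** Sums and products of coefficient sequences are those of polynomials, as far
as the coefficients below N are concerned. *)
Definition agree (N : nat) (f : fps) (P : {poly int}) :=
  forall i, (i < N)%N -> f i = P`_i.

Section Agree.
Variable N : nat.
Implicit Types (f g : fps) (P Q : {poly int}).

Lemma agree_mul f g P Q :
  agree N f P -> agree N g Q -> agree N (fps_mul f g) (P * Q).
Proof.
move=> fP gQ i lt_i; rewrite coefM; apply: eq_bigr => j _.
by rewrite fP ?gQ //; have := ltn_ord j; lia.
Qed.

Lemma agree_add f g P Q :
  agree N f P -> agree N g Q -> agree N (fps_add f g) (P + Q).
Proof. by move=> fP gQ i lt_i; rewrite coefD -fP // -gQ. Qed.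

Lemma agreeC c : agree N (fpsC c) c%:P.
Proof. by move=> [|i] _; rewrite coefC. Qed.

Lemma agreeX : agree N fpsX 'X.
Proof. by move=> [|[|i]] _; rewrite coefX. Qed.

Lemma agree_exp f P k : agree N f P -> agree N (fps_exp f k) (P ^+ k).
Proof.
move=> fP; elim: k => [|k IHk]; first exact: agreeC.
by rewrite exprS; apply: agree_mul.
Qed.

End Agree.

Lemma agree_deriv N f P : agree N.+1 f P -> agree N (fps_deriv f) P^`().
Proof. by move=> fP i lt_i; rewrite coef_deriv -fP. Qed.

Lemma agree_xm N : agree N.+1 (fps_mul fpsX motzkin_gf) (xm_poly N).
Proof.
move=> i lt_i; rewrite /xm_poly coefXM /fps_mul.
case: i lt_i => [|i] lt_i; first by rewrite big_ord1 mul0r.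
rewrite big_ord_recl mul0r add0r big_ord_recl mul1r big1 => [|j _]; last by rewrite mul0r.
by rewrite addr0 /= subSS subn0 coef_poly ltnS in lt_i *; rewrite lt_i.
Qed.

(** * The two formulas *)

Lemma card_DyckL_motzkin n p : prime p -> (3 <= p)%N -> (p <= n)%N ->
  #|DyckL n p| =
    (2 * (T (n - 2) (p - 1)
          + \sum_(0 <= i < n - 1 - p) i.+1 * M i * T (n - 4 - i) (p - 1)))%N.
Proof.
move=> p_prime p_ge3 le_pn.
have [n' Dn] : exists n', n = n'.+2 by exists (n - 2)%N; lia.
subst n; apply/eqP; rewrite -eqz_nat card_DyckL_coef //; apply/eqP.
set y := xm_poly _; set c := (p - 2)%N.
set P := 'X^c * (1 + y) ^+ c.
have coefP m : (m <= n')%N -> P`_m = (T m (p - 1))%:Z.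
  move=> le_mn; have -> : (p - 1 = c.+1)%N by rewrite /c; lia.
  rewrite gap_paths_T -(@coef_gap_paths n'.+1) ?leqW //.
  by rewrite expr0 mulr1.
rewrite addrC mulrDr mulr1 coefD coefP // -mulr_natl PoszM; congr (_ * _).
rewrite subSS subSS subn0 PoszD; congr (_ + _).
rewrite mulrCA coefXnM; case: ltnP => [lt_n2|le_2n].
  by rewrite big_geq //; lia.
rewrite mulrC coefM -natz.
rewrite -(big_mkord xpredT (fun j => y^`()`_j * P`_(n' - 2 - j))).
rewrite (@big_cat_nat _ _ _ (n'.+2 - 1 - p)%N) //=; last by lia.
(* The convolution has more terms than the formula; in the additional ones the
   first argument of T is too small. *)
rewrite [X in _ + X]big_nat_cond.
rewrite [X in _ + X]big1 ?addr0 => [|i /andP[/andP[le_i lt_i] _]]; last first.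
  rewrite coefP; last lia.
  rewrite /T ifF; last lia.
  rewrite ltn_eqF; last by lia.
  by rewrite mulr0.
rewrite natr_sum; apply: eq_big_nat => i /andP[_ lt_i].
rewrite coefP; last lia.
rewrite natz !PoszM; congr (_ * Posz (T _ _)).
rewrite coef_deriv -[y]expr1 coef_xm_poly_exp; last lia.
by rewrite M_motzkin_from -mulr_natl natz.
Qed.

Lemma dyckL_gfE p : prime p -> (3 <= p)%N ->
  dyckL_gf p =1
    (fpsC 2 * fpsX ^ p * (fpsC 1 + fpsX * motzkin_gf) ^ (p - 2)
     * (fpsX ^ 2 * fps_deriv (fpsX * motzkin_gf) + fpsC 1))%fps.
Proof.
move=> p_prime p_ge3 n.
pose c := (p - 2)%N.
(* F does not involve a truncation degree and allows a change of it: the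
   coefficient n of the product with x^p is the coefficient n - 2 of F. *)
pose F := (fpsX ^ c * (fpsC 1 + fpsX * motzkin_gf) ^ c
     * (fpsX ^ 2 * fps_deriv (fpsX * motzkin_gf) + fpsC 1))%fps.
pose P N : {poly int} :=
  'X^c * (1 + xm_poly N) ^+ c * ('X^2 * (xm_poly N)^`() + 1).
have yN N : agree N (fpsX * motzkin_gf)%fps (xm_poly N).
  by move=> i lt_i; apply: agree_xm; apply: leqW.
have F_P N : agree N F (P N).
  exact: (agree_mul (agree_mul (agree_exp c (@agreeX _))
     (agree_exp c (agree_add (agreeC 1) (yN N))))
    (agree_add (agree_mul (agree_exp 2 (@agreeX _)) (agree_deriv (@agree_xm N))) (agreeC 1))).
have -> : (fpsC 2 * fpsX ^ p * (fpsC 1 + fpsX * motzkin_gf) ^ c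
     * (fpsX ^ 2 * fps_deriv (fpsX * motzkin_gf) + fpsC 1))%fps n =
   (2%:P * 'X^p * (1 + xm_poly n.+1) ^+ c *
    ('X^2 * (xm_poly n.+1)^`() + 1))`_n.
  exact: (agree_mul (agree_mul (agree_mul (agreeC 2) (agree_exp p (@agreeX _)))
     (agree_exp c (agree_add (agreeC 1) (yN n.+1))))
    (agree_add (agree_mul (agree_exp 2 (@agreeX _)) (agree_deriv (@agree_xm n.+1))) (agreeC 1))).
have -> : 2%:P * 'X^p * (1 + xm_poly n.+1) ^+ c *
    ('X^2 * (xm_poly n.+1)^`() + 1) = 'X^2 * (P n.+1 *+ 2).
  have -> : 'X^p = 'X^2 * 'X^c :> {poly int} by rewrite -exprD subnKC // ltnW.
  have -> : 2%:P = 2 :> {poly int} by rewrite -polyC_natr.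
  by rewrite /P; ring.
rewrite coefXnM; case: n => [|[|n]] //=; first by rewrite card_DyckL_prime // big_ord0.
rewrite subSS subSS subn0 card_DyckL_coef // coefMn -/c -/(P n.+1).
by rewrite -!F_P // ltnW.
Qed.

Local Close Scope ring_scope.

Theorem theorem4p2 (p : nat) (p_prime : prime p) (p_ge3 : 3 <= p) :
  (forall n : nat, p <= n ->
     #|DyckL n p| =
       2 * (T (n - 2) (p - 1)
            + \sum_(0 <= i < n - 1 - p) i.+1 * M i * T (n - 4 - i) (p - 1)))
  /\
  dyckL_gf p =1
    (fpsC 2 * fpsX ^ p * (fpsC 1 + fpsX * motzkin_gf) ^ (p - 2)
     * (fpsX ^ 2 * fps_deriv (fpsX * motzkin_gf) + fpsC 1))%fps.
Proof.
split=> [n le_pn|]; first exact: card_DyckL_motzkin.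
exact: dyckL_gfE.
Qed.
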